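(* Let $F$ be an algebraically closed field of characteristic $0$, let $n\ge2$, $\Omega=\{1,\dots,n\}$, and let $\mathfrak{A}$ be the universal associative envelope of the anti-Jordan triple system of all $n\times n$ matrices over $F$, with generators $e_{i,j}$. For all $i,j,k,\ell\in\Omega$ the following identities hold in $\mathfrak{A}$. (1) $$\begin{aligned}e_{i,1}e_{1,j}\cdot e_{k,1}e_{1,\ell}=\;&\delta_{j,k}\delta_{\ell,1}\Big(\delta_{\ell,j}\delta_{i,1}e_{1,1}^4+\tfrac12\widehat\delta_{\ell,j}\delta_{i,1}(e_{1,1}^4+e_{1,1}^2)\Big)\\&+\tfrac12\Big[\delta_{j,k}\widehat\delta_{i,1}\delta_{i,\ell}\Big(2\delta_{\ell,j}\widehat\delta_{\ell,1}+\widehat\delta_{\ell,j}\big(\delta_{j,1}+\widehat\delta_{j,1}\widehat\delta_{\ell,1}\big)\Big)+\widehat\delta_{j,k}\delta_{k,\ell}\big(\widehat\delta_{j,1}\widehat\delta_{i,1}\delta_{i,j}+\delta_{j,1}\delta_{i,1}\big)\Big](e_{1,1}^4-e_{1,1}^2)\\&+\delta_{j,k}\Big(\delta_{\ell,1}\widehat\delta_{i,1}+\delta_{\ell,j}\widehat\delta_{\ell,1}+\widehat\delta_{\ell,j}\big(\delta_{j,1}+\widehat\delta_{j,1}\widehat\delta_{\ell,1}\big)\Big)e_{i,1}e_{1,\ell}.\end{aligned}$$ (2) If $(k,\ell)\ne(1,1)$: $$e_{i,1}e_{1,j}\cdot e_{1,k}e_{\ell,1}=\delta_{j,1}\widehat\delta_{k,1}\delta_{k,\ell}\tfrac12\Big(\delta_{i,1}(e_{1,1}^4+e_{1,1}^2)+2\widehat\delta_{i,1}e_{i,1}e_{1,1}\Big)-\delta_{k,1}\big(\delta_{j,1}\delta_{i,1}+\widehat\delta_{j,1}\widehat\delta_{\ell,1}\delta_{i,j}\big)e_{1,1}e_{\ell,1}.$$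 (3) If $\ell\ne1$: $\;e_{i,1}e_{1,j}\cdot e_{1,k}e_{1,1}e_{\ell,1}=-\delta_{k,1}\big(\delta_{i,1}\delta_{j,1}+\widehat\delta_{j,1}\delta_{i,j}\big)e_{1,1}^2e_{\ell,1}.$ (4) $$\begin{aligned}e_{i,1}e_{1,j}\cdot e_{1,1}^2e_{1,k}=\;&\delta_{j,1}\Big[\delta_{k,1}\Big(\delta_{i,1}e_{1,1}+\widehat\delta_{i,1}(e_{1,1}^2e_{i,1}+e_{i,1})\Big)+\widehat\delta_{k,1}\Big(\delta_{i,1}e_{1,1}^2e_{1,k}+\widehat\delta_{i,1}(e_{1,k}e_{1,1}e_{i,1}+e_{i,k})\Big)\Big]\\&-\widehat\delta_{j,1}\delta_{k,1}\delta_{i,j}\tfrac12(e_{1,1}^3-e_{1,1}).\end{aligned}$$ (5) $$e_{i,1}e_{1,j}\cdot e_{1,1}^4=\delta_{j,1}e_{i,1}e_{1,1}+\widehat\delta_{j,1}\delta_{j,i}\tfrac12(e_{1,1}^2-e_{1,1}^4).$$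
   Context: $\delta_{i,j}$ is the Kronecker delta and $\widehat\delta_{i,j}=1-\delta_{i,j}$. The anti-Jordan triple system of all $n\times n$ matrices over $F$ has trilinear product $\langle a,b,c\rangle=abc-cba$. Its universal associative envelope is $\mathfrak{A}=F\langle X\rangle/I$, where $F\langle X\rangle$ is the free unital associative algebra on symbols $X=\{e_{i,j}\}_{i,j\in\Omega}$ (with $e_{i,j}$ corresponding to the matrix unit $E_{i,j}$), and $I$ is the two-sided ideal generated by all elements $e_{i,j}e_{k,\ell}e_{m,t}-e_{m,t}e_{k,\ell}e_{i,j}-\delta_{j,k}\delta_{\ell,m}e_{i,t}+\delta_{t,k}\delta_{\ell,i}e_{m,j}$ for $i,j,k,\ell,m,t\in\Omega$. The image of $e_{i,j}$ in $\mathfrak{A}$ is again denoted $e_{i,j}$. *)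

(* Defs.v *)
From HB Require Import structures.
From mathcomp Require Import all_boot all_algebra.
From mathcomp Require Import boolp.
From mathcomp Require Import monalg.

Set Implicit Arguments.
Unset Strict Implicit.
Unset Printing Implicit Defensive.

Import GRing.Theory.

Local Open Scope ring_scope.
Local Open Scope quotient_scope.

(* The library makes {malg F[K]} an lalgType only, as it allows               *)
(* noncommutative coefficients.                                               *)
Lemma malg_scalerAr (F : fieldType) (K : monomType) (c : F)
  (x y : {malg F[K]}) : c *: (x * y) = x * (c *: y).
Proof.
have cC : x * c%:MP = c%:MP * x.
  rewrite !malgM_def fgmulgU fgmulUg; apply: eq_bigr => k _.
  by rewrite mulrC mulm1 mul1m.
by rewrite -!mul_malgC !mulrA cC.
Qed.

Definition free_alg (F : fieldType) (X : choiceType) := {malg F[{fmonom X}]}.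

Section FreeAlgebra.
Variables (F : fieldType) (X : choiceType).

HB.instance Definition _ := GRing.Lalgebra.on (free_alg F X).

Fact free_alg_scalerAr (c : F) (x y : free_alg F X) :
  c *: (x * y) = x * (c *: y).
Proof. exact: malg_scalerAr. Qed.

HB.instance Definition _ :=
  GRing.Lalgebra_isAlgebra.Build F (free_alg F X) free_alg_scalerAr.

Definition free_gen (x : X) : free_alg F X := << fmu x >>.

Definition free_aug (x : free_alg F X) : F := @mcoeff {fmonom X} F mone x.

Fact free_aug_zmod_morphism : zmod_morphism free_aug.
Proof. exact: (raddfB (@mcoeff {fmonom X} F mone)). Qed.

Fact free_aug_monoid_morphism : monoid_morphism free_aug.
Proof. by have [] := @mcoeff1g_is_multiplicative {fmonom X} F. Qed.

HB.instance Definition _ :=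
  GRing.isZmodMorphism.Build (free_alg F X) F free_aug free_aug_zmod_morphism.
HB.instance Definition _ :=
  GRing.isMonoidMorphism.Build (free_alg F X) F free_aug
    free_aug_monoid_morphism.

Lemma free_aug_gen (x : X) : free_aug (free_gen x) = 0.
Proof. by rewrite /free_aug mcoeffU1 fm1_eq1. Qed.

End FreeAlgebra.

Section QuotientAlgebra.
Variables (F : fieldType) (A : algType F) (S : A -> Prop).

Inductive gen_ideal : A -> Prop :=
| gen_ideal_gen x : S x -> gen_ideal x
| gen_ideal0 : gen_ideal 0
| gen_idealD x y : gen_ideal x -> gen_ideal y -> gen_ideal (x + y)
| gen_idealMl a x : gen_ideal x -> gen_ideal (a * x)
| gen_idealMr a x : gen_ideal x -> gen_ideal (x * a).

Definition gen_ideal_pred : A -> bool := fun x => `[< gen_ideal x >].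

Fact gen_ideal_zmod_closed : zmod_closed gen_ideal_pred.
Proof.
split=> [|x y /asboolP Ix /asboolP Iy]; apply/asboolP.
  exact: gen_ideal0.
by apply: gen_idealD => //; rewrite -mulN1r; apply: gen_idealMl.
Qed.

HB.instance Definition _ :=
  GRing.isZmodClosed.Build A gen_ideal_pred gen_ideal_zmod_closed.

Definition gen_ideal_closed : zmodClosed A :=
  GRing.ZmodClosed.clone A gen_ideal_pred _.

Definition quot_alg := Quotient.quot gen_ideal_closed.

HB.instance Definition _ := GRing.Zmodule.on quot_alg.
HB.instance Definition _ := EqQuotient.on quot_alg.

Definition quot_pi (x : A) : quot_alg := \pi_quot_alg x.

Lemma quot_pi_eq (x y : A) : quot_pi x = quot_pi y <-> gen_ideal (x - y).
Proof.
split=> [/eqP|Ixy]; last apply/eqP.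
  by rewrite -(Quotient.idealrBE gen_ideal_closed) => /asboolP.
by rewrite -(Quotient.idealrBE gen_ideal_closed); apply/asboolP.
Qed.

Lemma quot_reprK (x : quot_alg) : quot_pi (repr x) = x.
Proof. exact: reprK. Qed.

Lemma gen_ideal_repr (x : A) : gen_ideal (repr (quot_pi x) - x).
Proof. by apply/quot_pi_eq; rewrite quot_reprK. Qed.

Definition quot_mul (x y : quot_alg) : quot_alg := quot_pi (repr x * repr y).
Definition quot_scale (c : F) (x : quot_alg) : quot_alg :=
  quot_pi (c *: repr x).

Arguments quot_mul : simpl never.
Arguments quot_scale : simpl never.

Lemma quot_piD (x y : A) : quot_pi (x + y) = quot_pi x + quot_pi y.
Proof. exact: (@Quotient.pi_add A gen_ideal_closed x y). Qed.

Lemma quot_piM (x y : A) : quot_pi (x * y) = quot_mul (quot_pi x) (quot_pi y).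
Proof.
symmetry; apply/quot_pi_eq.
rewrite -(subrK (x * repr (quot_pi y)) (_ * _)) -mulrBl -addrA -mulrBr.
by apply: gen_idealD; [apply: gen_idealMr|apply: gen_idealMl];
  apply: gen_ideal_repr.
Qed.

Lemma quot_piZ (c : F) (x : A) : quot_pi (c *: x) = quot_scale c (quot_pi x).
Proof.
symmetry; apply/quot_pi_eq; rewrite -scalerBr -[_ - _]mul1r scalerAl.
by apply: gen_idealMl; apply: gen_ideal_repr.
Qed.

Fact quot_mulA : associative quot_mul.
Proof.
move=> x y z; rewrite -[x]quot_reprK -[y]quot_reprK -[z]quot_reprK.
by rewrite -!quot_piM mulrA.
Qed.

Fact quot_mul1x : left_id (quot_pi 1) quot_mul.
Proof. by move=> x; rewrite -[x]quot_reprK -quot_piM mul1r. Qed.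

Fact quot_mulx1 : right_id (quot_pi 1) quot_mul.
Proof. by move=> x; rewrite -[x]quot_reprK -quot_piM mulr1. Qed.

Fact quot_mulDl : left_distributive quot_mul +%R.
Proof.
move=> x y z; rewrite -[x]quot_reprK -[y]quot_reprK -[z]quot_reprK.
by rewrite -quot_piD -!quot_piM -quot_piD mulrDl.
Qed.

Fact quot_mulDr : right_distributive quot_mul +%R.
Proof.
move=> x y z; rewrite -[x]quot_reprK -[y]quot_reprK -[z]quot_reprK.
by rewrite -quot_piD -!quot_piM -quot_piD mulrDr.
Qed.

HB.instance Definition _ := GRing.Zmodule_isPzRing.Build quot_alg
  quot_mulA quot_mul1x quot_mulx1 quot_mulDl quot_mulDr.

Fact quot_scaleA a b x : quot_scale a (quot_scale b x) = quot_scale (a * b) x.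
Proof. by rewrite -[x]quot_reprK -!quot_piZ scalerA. Qed.

Fact quot_scale1 : left_id 1 quot_scale.
Proof. by move=> x; rewrite -[x]quot_reprK -quot_piZ scale1r. Qed.

Fact quot_scaleDr : right_distributive quot_scale +%R.
Proof.
move=> c x y; rewrite -[x]quot_reprK -[y]quot_reprK.
by rewrite -quot_piD -!quot_piZ -quot_piD scalerDr.
Qed.

Fact quot_scaleDl x : {morph quot_scale^~ x : a b / a + b}.
Proof. by move=> a b; rewrite -[x]quot_reprK -!quot_piZ -quot_piD scalerDl. Qed.

HB.instance Definition _ := GRing.Zmodule_isLmodule.Build F quot_alg
  quot_scaleA quot_scale1 quot_scaleDr quot_scaleDl.

Fact quot_pi_zmod_morphism : zmod_morphism quot_pi.
Proof.
move=> x y; apply/eqP; rewrite eq_sym subr_eq -quot_piD.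
by rewrite addrNK.
Qed.

Fact quot_pi_monoid_morphism : monoid_morphism quot_pi.
Proof. by split=> // x y; rewrite quot_piM. Qed.

Fact quot_pi_scalable : scalable quot_pi.
Proof. by move=> c x; rewrite quot_piZ. Qed.

HB.instance Definition _ :=
  GRing.isZmodMorphism.Build A quot_alg quot_pi quot_pi_zmod_morphism.
HB.instance Definition _ :=
  GRing.isMonoidMorphism.Build A quot_alg quot_pi quot_pi_monoid_morphism.
HB.instance Definition _ :=
  GRing.isScalable.Build F A quot_alg *:%R quot_pi quot_pi_scalable.

Lemma quot_pi_eq0 (x : A) : gen_ideal x -> quot_pi x = 0.
Proof.
by move=> Ix; rewrite -(raddf0 quot_pi); apply/quot_pi_eq; rewrite subr0.
Qed.

Lemma quot_scaleAl (c : F) (x y : quot_alg) : c *: (x * y) = (c *: x) * y.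
Proof.
rewrite -[x]quot_reprK -[y]quot_reprK.
by rewrite -rmorphM -!linearZ /= -rmorphM scalerAl.
Qed.

Lemma quot_scaleAr (c : F) (x y : quot_alg) : c *: (x * y) = x * (c *: y).
Proof.
rewrite -[x]quot_reprK -[y]quot_reprK.
by rewrite -rmorphM -!linearZ /= -rmorphM scalerAr.
Qed.

End QuotientAlgebra.

Lemma gen_ideal_ker (F : fieldType) (A : algType F) (S : A -> Prop)
    (R : pzRingType) (f : {rmorphism A -> R}) (x : A) :
  (forall y, S y -> f y = 0) -> gen_ideal S x -> f x = 0.
Proof.
move=> fS; elim=> {x} [x /fS //||x y _ fx _ fy|a x _ fx|a x _ fx].
- exact: rmorph0.
- by rewrite rmorphD fx fy addr0.
- by rewrite rmorphM fx mulr0.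
- by rewrite rmorphM fx mul0r.
Qed.

Lemma quot_alg_nontrivial (F : fieldType) (A : algType F) (S : A -> Prop)
    (R : nzRingType) (f : {rmorphism A -> R}) :
  (forall y, S y -> f y = 0) -> (1 : quot_alg S) != 0.
Proof.
move=> fS; apply/eqP => eq10; have /(gen_ideal_ker fS) : gen_ideal S (1 - 0).
  by apply/quot_pi_eq; rewrite rmorph0 rmorph1.
by rewrite subr0 rmorph1 => /eqP; rewrite oner_eq0.
Qed.

Definition delta (F : fieldType) (n : nat) (i j : 'I_n) : F := (i == j)%:R.
Definition codelta (F : fieldType) (n : nat) (i j : 'I_n) : F :=
  1 - delta F i j.

Arguments delta : simpl never.
Arguments codelta : simpl never.

Section Relation.
Variables (F : fieldType) (n : nat) (A : algType F) (e : 'I_n -> 'I_n -> A).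

Definition ajts_relation (x : A) : Prop :=
  exists i j k l m t : 'I_n,
    x = e i j * e k l * e m t - e m t * e k l * e i j
        - (delta F j k * delta F l m) *: e i t
        + (delta F t k * delta F l i) *: e m j.

Lemma ajts_relation_ker (R : pzRingType) (f : {rmorphism A -> R}) (x : A) :
  (forall i j, f (e i j) = 0) -> ajts_relation x -> f x = 0.
Proof.
move=> fe [i [j [k [l [m [t ->]]]]]].
have fZ c i' j' : f (c *: e i' j') = 0 by rewrite -mulr_algl rmorphM fe mulr0.
by rewrite rmorphD !rmorphB !fZ !rmorphM !fe !mulr0 !subr0 addr0.
Qed.

Local Notation q := (quot_pi ajts_relation).

Lemma ajts_quotP (i j k l m t : 'I_n) :
  q (e i j) * q (e k l) * q (e m t) - q (e m t) * q (e k l) * q (e i j)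
  - (delta F j k * delta F l m) *: q (e i t)
  + (delta F t k * delta F l i) *: q (e m j) = 0.
Proof.
transitivity (q (e i j * e k l * e m t - e m t * e k l * e i j
    - (delta F j k * delta F l m) *: e i t
    + (delta F t k * delta F l i) *: e m j)).
  by rewrite rmorphD !rmorphB /= !quot_pi_scalable !rmorphM.
by apply: quot_pi_eq0; apply: gen_ideal_gen; exists i, j, k, l, m, t.
Qed.

End Relation.

Definition envelope (F : fieldType) (n : nat) :=
  quot_alg (ajts_relation (fun i j : 'I_n => free_gen F (i, j))).

Section Envelope.
Variables (F : fieldType) (n : nat).

HB.instance Definition _ := GRing.PzRing.on (envelope F n).
HB.instance Definition _ := GRing.Lmodule.on (envelope F n).

Fact envelope_nontrivial : (1 : envelope F n) != 0.
Proof.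
apply: (@quot_alg_nontrivial _ _ _ _ (@free_aug F ('I_n * 'I_n)%type)) => y.
by apply: ajts_relation_ker => i j; apply: free_aug_gen.
Qed.

HB.instance Definition _ :=
  GRing.PzSemiRing_isNonZero.Build (envelope F n) envelope_nontrivial.
HB.instance Definition _ :=
  GRing.Lmodule_isLalgebra.Build F (envelope F n) (@quot_scaleAl _ _ _).
HB.instance Definition _ :=
  GRing.Lalgebra_isAlgebra.Build F (envelope F n) (@quot_scaleAr _ _ _).

Definition envelope_gen (i j : 'I_n) : envelope F n :=
  quot_pi _ (free_gen F (i, j)).

Lemma envelope_genP (i j k l m t : 'I_n) :
  envelope_gen i j * envelope_gen k l * envelope_gen m t
  - envelope_gen m t * envelope_gen k l * envelope_gen i j
  - (delta F j k * delta F l m) *: envelope_gen i t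
  + (delta F t k * delta F l i) *: envelope_gen m j = 0.
Proof. exact: ajts_quotP. Qed.

End Envelope.

(* Main.v *)
Require Import Defs.
From mathcomp Require Import all_boot all_algebra.

Set Implicit Arguments.
Unset Strict Implicit.
Unset Printing Implicit Defensive.

Import GRing.Theory.
Local Open Scope ring_scope.

(** The identities hold because the envelope behaves like a direct sum of copies
    of the n x n matrices (and the ground field): the defining relations are
    satisfied by c E_ij with c^2 = 1 and by c E_ji with c^2 = -1, and products
    of the generators can be computed as if these were the only representations
    with nonzero generators.  The proof makes this explicit without any
    representation theory.

    Write [a,b,c] = abc - cba.  Exchanging the outer factors of abc and of bcd
    in a product abcd are commuting operations, and comparing the two orders
    gives ([swap_swap])
      c [b,a,d] + [a,b,c] d = a [b,c,d] + [a,d,c] b.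
    In the envelope every bracket is linear in the generators, so this is a
    quadratic relation.  Two choices of matrix units yield everything that is
    needed in degree two: e_ij e_kl = 0 for j <> k, i <> l ([gen_mul0]), and
    for i <> l the product e_ij e_jl does not depend on j ([gen_mul_row]).
    Transposition turns the family e into one whose brackets have the opposite
    sign, so the same holds for e_ij e_ki with j <> k ([gen_mul_col]).

    The freedom in the middle index is the engine of the proof: one picks it so
    that the product with a neighbouring generator vanishes.  The elements
    u_il = e_ij e_jl thus multiply like matrix units of the summands
    where e_ij acts as c E_ij, the elements v_jk = e_ij e_ki like
    those, up to sign, of the summands where e_ij acts as c E_ji, and uv = 0.
    On the diagonal, e_ij e_ji = P_i - Q_j with P_i = u_ip u_pi and
    Q_j = v_jq v_qj ([loop_corners]).

    With x = e_oo, P = P_o and Q = Q_o this gives x^2 = P - Q and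
    x^4 = x^2 + 2 Q, so that (x^4 - x^2) / 2 = Q and (x^4 + x^2) / 2 = P; the
    cubic relation for x, e_op, e_po gives x = x P + Q x, whence x^5 = x.  Each
    identity is then a case distinction on which indices coincide. *)

(** * Families of generators and their transposes *)

(** The sign makes the notion stable under transposition: the envelope gives
    the positive sign, the transposed generators the negative one. *)
Definition ajts_family (A : pzRingType) (n : nat) (s : bool)
    (e : 'I_n -> 'I_n -> A) : Prop :=
  forall i j k l m t,
    e i j * e k l * e m t - e m t * e k l * e i j =
    (-1) ^+ s * (e i t *+ ((j == k) && (l == m))
                 - e m j *+ ((t == k) && (l == i))).

Definition transpose (A : Type) (n : nat) (e : 'I_n -> 'I_n -> A) :=
  fun i j => e j i.

(** The value at j = i of e_ij e_jl, which for i <> l does not depend on j. *)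
Definition unit2 (A : pzRingType) (n : nat) (e : 'I_n -> 'I_n -> A) i l :=
  e i i * e i l.

(** For p <> i it acts as E_ii where e_ij acts as c E_ij, and as 0 where e_ij
    acts as c E_ji; the corner of the transposed family does the reverse. *)
Definition corner (A : pzRingType) (n : nat) (e : 'I_n -> 'I_n -> A) i p :=
  unit2 e i p * unit2 e p i.

Lemma transpose_family (A : pzRingType) n s (e : 'I_n -> 'I_n -> A) :
  ajts_family s e -> ajts_family (~~ s) (transpose e).
Proof.
move=> He i j k l m t; rewrite /transpose He signrN mulNr -mulrN opprB.
by congr (_ * (_ *+ nat_of_bool _ - _ *+ nat_of_bool _));
  rewrite andbC; congr andb; apply: eq_sym.
Qed.

Lemma two_indices n (i : 'I_n) : (2 <= n)%N -> exists j : 'I_n, j != i.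
Proof.
move=> n2; have n0 := ltnW n2.
by case: (eqVneq i (Ordinal n0)) => [->|];
  [exists (Ordinal n2) | exists (Ordinal n0); rewrite eq_sym].
Qed.

(** Both sides equal abcd - cdab: they record the two orders in which abcd can
    be turned into cdab by exchanging the first and third factors, and the
    second and fourth ones. *)
Lemma swap_swap (A : pzRingType) (a b c d : A) :
  c * (b * a * d - d * a * b) + (a * b * c - c * b * a) * d =
  a * (b * c * d - d * c * b) + (a * d * c - c * d * a) * b.
Proof. by rewrite !mulrBr !mulrBl !mulrA [LHS]addrC !subrKA. Qed.

(** * Quadratic relations *)

Ltac eval_deltas :=
  repeat match goal with
  | H : is_true (?a != ?b) |- context [?a == ?b] => rewrite (negPf H)
  | H : is_true (?a != ?b) |- context [?b == ?a] =>
      rewrite [b == a]eq_sym (negPf H)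
  end;
  rewrite ?eqxx ?andbF ?andbT ?mulr0n ?mulr1n ?subrr ?subr0 ?sub0r
    ?mulr0 ?mul0r ?add0r ?addr0.

Section Family.

Variables (A : pzRingType) (n : nat) (s : bool) (e : 'I_n -> 'I_n -> A).
Hypothesis two_reg : forall x : A, x + x = 0 -> x = 0.
Hypothesis n_ge2 : (2 <= n)%N.
Hypothesis eP : ajts_family s e.

(** In [swap_swap] with a = e_ij, b = e_ki, c = e_ik, d = e_kl only
    cba = e_ij and bcd = e_kl survive as matrix products, and both contribute
    the same multiple of e_ij e_kl; hence the need to divide by 2. *)
Lemma gen_mul0 i j k l : j != k -> i != l -> e i j * e k l = 0.
Proof.
move=> jk il; have := swap_swap (e i j) (e k i) (e i k) (e k l).
rewrite !eP; eval_deltas; rewrite !mulr_sign => eq_opp; apply: two_reg.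
have {1}-> : e i j * e k l = - (e i j * e k l); last exact: addNr.
by case: (s) eq_opp; rewrite ?mulrN ?mulNr ?opprK.
Qed.

(** In [swap_swap] with a = e_ij, b = e_jj, c = e_jp, d = e_pl only abc = e_ip
    and bcd = e_jl survive as matrix products. *)
Lemma gen_mul_row i l j p : i != l -> e i j * e j l = e i p * e p l.
Proof.
case: (eqVneq j p) => [-> // | jp il].
have := swap_swap (e i j) (e j j) (e j p) (e p l).
rewrite !eP; eval_deltas; rewrite !mulr_sign.
by case: (s); rewrite ?mulNr ?mulrN => // /oppr_inj.
Qed.

Lemma triple_swap i j k l m t :
  e i j * e k l * e m t = e m t * e k l * e i j +
    (-1) ^+ s * (e i t *+ ((j == k) && (l == m))
                 - e m j *+ ((t == k) && (l == i))).
Proof. by rewrite -eP [RHS]addrC subrK. Qed.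

(** The middle index of the degree-two unit is chosen different from a, so that
    [gen_mul0] applies to the first two factors. *)
Lemma gen_unit2_0 a b i l : b != i -> i != l -> e a b * unit2 e i l = 0.
Proof.
move=> bi il; have [j ja] := two_indices a n_ge2.
by rewrite /unit2 (gen_mul_row i j il) mulrA gen_mul0 ?mul0r // eq_sym.
Qed.

Lemma unit2_gen0 i l a b : l != a -> i != l -> unit2 e i l * e a b = 0.
Proof.
move=> la il; have [j jb] := two_indices b n_ge2.
by rewrite /unit2 (gen_mul_row i j il) -mulrA gen_mul0 ?mulr0.
Qed.

(** With middle index p <> q, the cubic relation moves e_jq to the front of
    e_ip e_pj e_jq; the reordered term dies because e_ip e_qj = 0. *)
Lemma unit2_mul_loop i j q :
  i != j -> unit2 e i j * (e j q * e q j) = (-1) ^+ s * unit2 e i j.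
Proof.
move=> ij; have [p pq] := two_indices q n_ge2.
rewrite /unit2 (gen_mul_row i p ij) mulrA triple_swap; eval_deltas.
rewrite mulrDl -!mulrA gen_mul0 // !mulr0 add0r.
by rewrite (gen_mul_row q p ij).
Qed.

Lemma loop_mul_unit2 i l q :
  i != l -> e i q * e q i * unit2 e i l = (-1) ^+ s * unit2 e i l.
Proof.
move=> il; have [p pq] := two_indices q n_ge2.
rewrite /unit2 (gen_mul_row i p il) -mulrA [X in e i q * X]mulrA triple_swap.
eval_deltas; rewrite mulrDr !mulrA gen_mul0 //; last by rewrite eq_sym.
rewrite !mul0r add0r commr_sign -!mulrA; congr (_ * _).
exact: gen_mul_row.
Qed.

End Family.

Section FamilyTranspose.

Variables (A : pzRingType) (n : nat) (s : bool) (e : 'I_n -> 'I_n -> A).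
Hypothesis two_reg : forall x : A, x + x = 0 -> x = 0.
Hypothesis n_ge2 : (2 <= n)%N.
Hypothesis eP : ajts_family s e.

Let teP : ajts_family (~~ s) (transpose e) := transpose_family eP.

Lemma gen_mul_col j k i p : j != k -> e i j * e k i = e p j * e k p.
Proof. by move=> jk; exact: (gen_mul_row teP i p jk). Qed.

(** The two types of representations do not interact. *)
Lemma unit2_transpose0 i j k l :
  i != j -> k != l -> unit2 e i j * unit2 (transpose e) k l = 0.
Proof.
move=> ij kl; have [p pj] := two_indices j n_ge2.
rewrite /unit2 (gen_mul_row teP k p kl) mulrA /transpose.
by rewrite (unit2_gen0 two_reg n_ge2 eP) ?mul0r // eq_sym.
Qed.

(** The off-diagonal independence of the middle index fails on the diagonal by
    exactly these two corners.  Writing the degree-two units in the corners with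
    suitable middle indices, the first corner is e_ij (e_jp e_pj e_ji) and the
    second e_ij (e_ji e_pj e_jp): the cubic relation compares them. *)
Lemma loop_corners i j p q : p != i -> q != j ->
  e i j * e j i = (-1) ^+ s * (corner e i p - corner (transpose e) j q).
Proof.
move=> pi qj.
have P_ij : corner e i p = e i j * (e j p * e p j * e j i).
  rewrite /corner /unit2 (gen_mul_row eP i j) 1?eq_sym //.
  by rewrite (gen_mul_row eP p j pi) !mulrA.
have Q_ij : corner (transpose e) j q = e i j * (e j i * e p j * e j p).
  rewrite /corner /unit2 /transpose (gen_mul_col j i) 1?eq_sym //.
  rewrite (gen_mul_col q p qj) -mulrA [X in e i j * X]mulrA.
  by rewrite (gen_mul_col q j) 1?eq_sym // !mulrA.
rewrite P_ij Q_ij (triple_swap eP); eval_deltas.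
rewrite -mulrBr addrAC subrr add0r !mulr_sign.
by case: (s); rewrite ?mulrN ?opprK.
Qed.

End FamilyTranspose.

(** * Products at a base point *)

Section BasePoint.

Variables (A : pzRingType) (n : nat) (e : 'I_n -> 'I_n -> A).
Hypothesis two_reg : forall x : A, x + x = 0 -> x = 0.
Hypothesis n_ge2 : (2 <= n)%N.
Hypothesis eP : ajts_family false e.
Variables (o p : 'I_n).
Hypothesis po : p != o.

Let teP : ajts_family true (transpose e) := transpose_family eP.
Let op : o != p. Proof. by rewrite eq_sym. Qed.

Local Notation x := (e o o).
Local Notation P := (corner e o p).
Local Notation Q := (corner (transpose e) o p).

Lemma corner_transpose_loop q : Q * (e q o * e o q) = - Q.
Proof.
rewrite {1}/corner -mulrA.
rewrite [X in _ * X](unit2_mul_loop two_reg n_ge2 teP q po).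
by rewrite mulr_sign mulrN.
Qed.

Lemma corner_loop q : P * (e o q * e q o) = P.
Proof.
rewrite {1}/corner -mulrA (unit2_mul_loop two_reg n_ge2 eP q po).
by rewrite expr0 mul1r.
Qed.

Lemma loopE l q : q != l -> e l o * e o l = corner e l q - Q.
Proof. by move=> ql; rewrite (loop_corners eP ql po) expr0 mul1r. Qed.

(** The middle pair e_oj e_ko may be replaced by e_pj e_kp, and p <> o makes the
    outer products vanish unless the indices match. *)
Lemma four_gens_off i j k l : j != k ->
  e i o * e o j * (e k o * e o l) = Q *+ ((i == j) && (k == l)).
Proof.
move=> jk; rewrite -mulrA [X in _ * X]mulrA (gen_mul_col eP o p jk).
case: (eqVneq i j) => [-> | ij]; last first.
  by rewrite !mulrA (gen_mul0 two_reg eP) ?mul0r.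
case: (eqVneq k l) => [<- | kl]; last first.
  by rewrite -mulrA (gen_mul0 two_reg eP po kl) !mulr0.
rewrite !mulrA -mulrA (gen_mul_col eP j o op) (gen_mul_col eP k p po).
by rewrite mulr1n.
Qed.

(** The cubic relation for e_oj e_jo e_ol leaves e_ol and a reordered product
    that falls under [four_gens_off]. *)
Lemma four_gens_on i j l : l != j ->
  e i o * e o j * (e j o * e o l) = Q *+ (i == l) + e i o * e o l.
Proof.
move=> lj; rewrite -mulrA [X in _ * X]mulrA (triple_swap eP); eval_deltas.
rewrite expr0 mul1r mulrDr -[X in _ * X]mulrA mulrA four_gens_off //.
by rewrite eqxx andbT.
Qed.

(** On the diagonal this says (P_j - Q)^2 = P_j + Q = (P_j - Q) + 2 Q. *)
Lemma four_gens_loop i j :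
  e i o * e o j * (e j o * e o j) = (Q + Q) *+ (i == j) + e i o * e o j.
Proof.
case: (eqVneq i j) => [-> | ij].
  have [q qj] := two_indices j n_ge2.
  rewrite {1 3}(loopE qj) mulrBl corner_transpose_loop.
  rewrite {1}/corner -mulrA (unit2_mul_loop two_reg n_ge2 eP o qj).
  by rewrite expr0 mul1r opprK mulr1n addrACA addrN addr0 addrC.
rewrite (gen_mul_row eP o i ij) -/(unit2 e i j).
by rewrite (unit2_mul_loop two_reg n_ge2 eP o ij) add0r mul1r.
Qed.

Lemma base_expr4 : x ^+ 4 = x ^+ 2 + (Q + Q).
Proof.
by rewrite -[4%N]/(2 + 2)%N exprD !expr2 four_gens_loop eqxx addrC.
Qed.

Lemma corner_transposeE : Q + Q = x ^+ 4 - x ^+ 2.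
Proof. by rewrite base_expr4 addrAC subrr add0r. Qed.

Lemma base_expr5 : x ^+ 4 * x = x.
Proof.
(* The corners at p that appear along the way are killed by x, since p <> o. *)
have xPQ : x = x * P + Q * x.
  have := triple_swap eP o o o p p o; eval_deltas; rewrite expr0 mul1r.
  rewrite -mulrA (loop_corners eP po op) (loop_corners eP op po).
  rewrite !expr0 !mul1r mulrBr mulrBl {2 3}/corner mulrA.
  rewrite (gen_unit2_0 two_reg n_ge2 teP o op po) mul0r subr0.
  rewrite -[unit2 e p o * _ * _]mulrA (unit2_gen0 two_reg n_ge2 eP o po op).
  by rewrite mulr0 sub0r => ->; rewrite addrC addNKr.
have PE : P = x ^+ 2 + Q by rewrite expr2 (loopE po) subrK.
apply/eqP; rewrite -subr_eq0; apply/eqP/two_reg.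
have PPE : P + P = x ^+ 4 + x ^+ 2.
  by rewrite PE addrACA corner_transposeE addrCA addrK.
have xx : x + x = x ^+ 5 + x ^+ 5.
  transitivity (x * (P + P) + (Q + Q) * x).
    by rewrite mulrDr mulrDl addrACA -xPQ.
  rewrite PPE corner_transposeE.
  by rewrite mulrDr mulrBl -!exprS -!exprSr addrACA subrr addr0.
by rewrite -exprSr addrACA -opprD xx subrr.
Qed.

Lemma gens_mixed_off i j k l : j != o -> k != o ->
  e i o * e o j * (e o k * e l o) = 0.
Proof.
move=> jo ko; rewrite -mulrA [X in _ * X]mulrA.
by rewrite (gen_mul0 two_reg eP) ?mul0r ?mulr0 // eq_sym.
Qed.

Lemma gens_mixed_col k l i : k != o -> k != l ->
  e i o * x * (e o k * e l o) = 0.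
Proof.
move=> ko kl; rewrite -mulrA (gen_mul_col eP o k kl).
rewrite [X in _ * X](gen_unit2_0 two_reg n_ge2 teP o _ kl) ?mulr0 //.
by rewrite eq_sym.
Qed.

Lemma gens_mixed_loop i k : k != o ->
  e i o * x * (e o k * e k o) = e i o * x + Q *+ (i == o).
Proof.
move=> ko; case: (eqVneq i o) => [-> | io].
  have Qk0 : Q * e o k = 0.
    rewrite /corner -mulrA.
    rewrite [X in _ * X](unit2_gen0 two_reg n_ge2 teP o _ po) ?mulr0 //.
    by rewrite eq_sym.
  rewrite {1}(loopE po) mulrBl corner_loop [X in _ - X]mulrA Qk0.
  by rewrite mul0r subr0 (loopE po) mulr1n subrK.
rewrite (gen_mul_row eP o i io) -/(unit2 e i o).
by rewrite (unit2_mul_loop two_reg n_ge2 eP k io) mul1r addr0.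
Qed.

(** The factor x e_lo is a degree-two unit of the transposed family, on which
    e_io e_oi acts as -1. *)
Lemma gens_unit2_transpose i j l : l != o ->
  e i o * e o j * (x * e l o) = - (x * e l o) *+ (i == j).
Proof.
move=> lo; have ol : o != l by rewrite eq_sym.
case: (eqVneq i j) => [-> | ij].
  by rewrite [LHS](loop_mul_unit2 two_reg n_ge2 teP j ol) mulr_sign.
rewrite (gen_mul_row eP o i ij).
exact: (unit2_transpose0 two_reg n_ge2 eP ij ol).
Qed.

Lemma gens_base_off k i j l : k != o -> l != o ->
  e i o * e o j * (e o k * x * e l o) = 0.
Proof.
move=> ko lo; have ol : o != l by rewrite eq_sym.
have ok : o != k by rewrite eq_sym.
case: (eqVneq j o) => [-> | jo].
  rewrite -mulrA [X in _ * X](_ : _ = 0) ?mulr0 // -mulrA mulrA.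
  exact: (unit2_transpose0 two_reg n_ge2 eP ok ol).
rewrite -mulrA -(mulrA (e o k)) [X in _ * X]mulrA.
by rewrite (gen_mul0 two_reg eP jo ok) mul0r mulr0.
Qed.

Lemma loop_base i : i != o -> e i o * e o i * x = x * (e o i * e i o) - x.
Proof.
move=> io; rewrite (triple_swap eP); eval_deltas.
by rewrite expr0 mul1r mulrA.
Qed.

Lemma unit2_base0 i j : i != j -> j != o -> e i o * e o j * x = 0.
Proof.
move=> ij jo; rewrite (gen_mul_row eP o i ij).
exact: (unit2_gen0 two_reg n_ge2 eP o jo ij).
Qed.

Lemma gen_unit2_transpose0 i l : i != o -> l != o -> e i o * (x * e l o) = 0.
Proof.
move=> io lo; have ol : o != l by rewrite eq_sym.
exact: (gen_unit2_0 two_reg n_ge2 teP o io ol).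
Qed.

(** For i = j <> o, x is moved to the left of the loop e_io e_oi by the cubic
    relation, after which e_io annihilates x e_lo. *)
Lemma gens_base_on i j l : l != o ->
  e i o * e o j * (x * x * e l o) = - (x ^+ 2 * e l o) *+ (i == j).
Proof.
move=> lo; have ol : o != l by rewrite eq_sym.
have xxE : x * x * (x * e l o) = - (x * e l o).
  by rewrite [LHS](loop_mul_unit2 two_reg n_ge2 teP o ol) mulr_sign.
rewrite expr2 -(mulrA x) mulrA.
case: (eqVneq i j) => [-> | ij].
  case: (eqVneq j o) => [-> | jo]; last first.
    rewrite loop_base // mulrBl -mulrA -[_ * e j o * _]mulrA.
    by rewrite gen_unit2_transpose0 // !mulr0 sub0r.
  by rewrite -[x * x * x]mulrA -mulrA xxE mulrN.
case: (eqVneq j o) ij => [-> | jo] ij; last by rewrite unit2_base0 // mul0r.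
by rewrite -[e i o * x * x]mulrA -mulrA xxE mulrN gen_unit2_transpose0 ?oppr0.
Qed.

Lemma gens_cube i j : j != o ->
  e i o * e o j * x ^+ 3 = (Q * x) *+ (i == j).
Proof.
move=> jo; case: (eqVneq i j) => [-> | ij].
  by rewrite exprSr expr2 [LHS]mulrA four_gens_off // !eqxx.
by rewrite exprS mulrA unit2_base0 ?mul0r.
Qed.

Lemma base_expr3_row k : k != o -> x ^+ 3 * e o k = x * e o k.
Proof.
move=> ko; have ok : o != k by rewrite eq_sym.
rewrite exprSr expr2 -mulrA.
by rewrite [LHS](loop_mul_unit2 two_reg n_ge2 eP o ok) mul1r.
Qed.

Lemma col_base_expr3 i : i != o -> e i o * x ^+ 3 = e i o * x.
Proof.
move=> io; rewrite exprS expr2 [LHS]mulrA four_gens_loop (negPf io).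
by rewrite add0r.
Qed.

Lemma gens_base4 i : i != o -> e i o * x ^+ 4 = x ^+ 2 * e i o + e i o.
Proof.
move=> io; rewrite exprSr mulrA col_base_expr3 // (triple_swap eP); eval_deltas.
by rewrite mul1r expr2.
Qed.

Lemma gens_base_row_off i j k : j != o -> k != o ->
  e i o * e o j * (x ^+ 2 * e o k) = 0.
Proof.
move=> jo ko; have ok : o != k by rewrite eq_sym.
rewrite -mulrA expr2 [X in _ * X](_ : _ = 0) ?mulr0 //.
rewrite -mulrA mulrA (gen_mul_col eP o j jo).
exact: (unit2_transpose0 two_reg n_ge2 teP jo ok).
Qed.

Lemma gens_base_row_on i k : i != o -> k != o ->
  e i o * x * (x ^+ 2 * e o k) = e o k * x * e i o + e i k.
Proof.
move=> io ko; rewrite mulrA -[e i o * x * _]mulrA -exprS col_base_expr3 //.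
rewrite (triple_swap eP).
by eval_deltas; rewrite mul1r.
Qed.

Lemma gens_expr4 i j : j != o ->
  e i o * e o j * x ^+ 4 = - Q *+ (i == j).
Proof.
move=> jo; rewrite exprSr mulrA gens_cube //.
case: (i == j); rewrite ?mul0r //.
by rewrite -mulrA corner_transpose_loop.
Qed.

End BasePoint.

(** * The envelope *)

Lemma envelope_family (F : fieldType) (n : nat) :
  ajts_family false (@envelope_gen F n).
Proof.
move=> i j k l m t; have /eqP := envelope_genP F i j k l m t.
rewrite addr_eq0 subr_eq /delta -!natrM !mulnb !scaler_nat => /eqP ->.
by rewrite expr0 mul1r addrC.
Qed.

Lemma char0_two_neq0 (F : fieldType) : [pchar F] =i pred0 -> (2 : F) != 0.
Proof. by move=> charF0; rewrite ((pcharf0P F).1 charF0). Qed.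

Lemma lmod_double_eq0 (F : fieldType) (V : lmodType F) (x : V) :
  (2 : F) != 0 -> x + x = 0 -> x = 0.
Proof.
move=> two0 /eqP; rewrite -mulr2n -scaler_nat scaler_eq0 (negPf two0).
by move/eqP.
Qed.

(** * The identities with their Kronecker deltas *)

Ltac simp_scalars :=
  eval_deltas;
  rewrite ?(mulr1, mul1r, mulr0, mul0r, subr0, subrr, addr0, add0r,
            scale0r, scale1r, scaler0, oppr0).

Section Scalars.

Variables (F : fieldType) (two0 : (2 : F) != 0).
Variables (A : lalgType F) (n : nat) (n_ge2 : (2 <= n)%N).
Variables (e : 'I_n -> 'I_n -> A) (eP : ajts_family false e) (o : 'I_n).

Local Notation d a b := (delta F a b).
Local Notation d' a b := (codelta F a b).
Local Notation half := (2^-1 : F).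
Local Notation x := (e o o).

Let two_reg (y : A) : y + y = 0 -> y = 0.
Proof. exact: lmod_double_eq0. Qed.

Lemma half_double (V : lmodType F) (y : V) : half *: (y + y) = y.
Proof. by rewrite -mulr2n -scaler_nat scalerA mulVf ?scale1r. Qed.

Lemma half_expr_sub p : p != o ->
  half *: (x ^+ 4 - x ^+ 2) = corner (transpose e) o p.
Proof.
by move=> po; rewrite -(corner_transposeE two_reg n_ge2 eP po) half_double.
Qed.

Lemma half_expr_add p : p != o ->
  half *: (x ^+ 4 + x ^+ 2) = x ^+ 2 + corner (transpose e) o p.
Proof.
move=> po; rewrite (base_expr4 two_reg n_ge2 eP po).
by rewrite addrAC addrACA half_double.
Qed.

Lemma four_gens i j k l :
  (e i o * e o j) * (e k o * e o l) =
    (d j k * d l o) *: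
      ((d l j * d i o) *: x ^+ 4
       + (half * d' l j * d i o) *: (x ^+ 4 + x ^+ 2))
    + (half *
         (d j k * d' i o * d i l *
            (2 * d l j * d' l o + d' l j * (d j o + d' j o * d' l o))
          + d' j k * d k l * (d' j o * d' i o * d i j + d j o * d i o))) *:
        (x ^+ 4 - x ^+ 2)
    + (d j k *
         (d l o * d' i o + d l j * d' l o
          + d' l j * (d j o + d' j o * d' l o))) *:
        (e i o * e o l).
Proof.
have [p po] := two_indices o n_ge2.
have QE := half_expr_sub po; have PQE := half_expr_add po.
rewrite /codelta /delta; case: (eqVneq j k) => [<- | jk].
  case: (eqVneq l j) => [-> | lj].
    rewrite (four_gens_loop two_reg n_ge2 eP po).
    case: (eqVneq j o) => [-> | jo]; last first.
      case: (eqVneq i j) => [-> | ij].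
        simp_scalars; rewrite (corner_transposeE two_reg n_ge2 eP po).
        by rewrite mulVf // scale1r.
      by simp_scalars.
    case: (eqVneq i o) => [-> | io]; last by simp_scalars.
    by simp_scalars; rewrite -expr2 (base_expr4 two_reg n_ge2 eP po) addrC.
  rewrite (four_gens_on two_reg eP po i lj).
  case: (eqVneq l o) lj => [-> | lo] lj.
    case: (eqVneq i o) => [-> | io]; simp_scalars => //.
    by rewrite PQE addrC.
  case: (eqVneq i l) => [-> | il].
    by case: (eqVneq j o) => [-> | jo]; simp_scalars; rewrite QE.
  by case: (eqVneq j o) => [-> | jo]; simp_scalars.
rewrite (four_gens_off two_reg eP po i l jk).
case: (eqVneq k l) => [_ | kl]; last by simp_scalars.
case: (eqVneq i j) => [-> | ij].
  by case: (eqVneq j o) => [-> | jo]; simp_scalars; rewrite QE.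
case: (eqVneq j o) => [jo | jo]; last by simp_scalars.
by rewrite -jo; simp_scalars.
Qed.

Lemma mixed_gens i j k l : (k, l) <> (o, o) ->
  (e i o * e o j) * (e o k * e l o) =
    (d j o * d' k o * d k l * half) *:
      (d i o *: (x ^+ 4 + x ^+ 2) + (2 * d' i o) *: (e i o * x))
    - (d k o * (d j o * d i o + d' j o * d' l o * d i j)) *: (x * e l o).
Proof.
have [p po] := two_indices o n_ge2.
have PQE := half_expr_add po.
move=> kl_o; rewrite /codelta /delta.
case: (eqVneq k o) kl_o => [-> | ko] kl_o.
  have lo : l != o by apply: contra_notN kl_o => /eqP ->.
  rewrite (gens_unit2_transpose two_reg n_ge2 eP) //.
  case: (eqVneq i j) => [-> | ij].
    by case: (eqVneq j o) => [-> | jo]; simp_scalars; rewrite ?mulr1n.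
  case: (eqVneq j o) => [jo | jo]; last by simp_scalars.
  by rewrite -jo; simp_scalars.
case: (eqVneq j o) => [-> | jo]; last first.
  by rewrite (gens_mixed_off two_reg eP) //; simp_scalars.
case: (eqVneq k l) => [<- | kl]; last first.
  by rewrite (gens_mixed_col two_reg n_ge2 eP) //; simp_scalars.
rewrite (gens_mixed_loop two_reg n_ge2 eP po) //.
case: (eqVneq i o) => [-> | io]; simp_scalars; first by rewrite PQE.
by rewrite scalerA mulVf ?scale1r.
Qed.

Lemma mixed_gens_base i j k l : l <> o ->
  (e i o * e o j) * (e o k * x * e l o) =
    - ((d k o * (d i o * d j o + d' j o * d i j)) *: (x ^+ 2 * e l o)).
Proof.
move=> /eqP lo; rewrite /codelta /delta.
case: (eqVneq k o) => [-> | ko]; last first.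
  by rewrite (gens_base_off two_reg n_ge2 eP) //; simp_scalars.
rewrite (gens_base_on two_reg n_ge2 eP) //.
case: (eqVneq i j) => [-> | ij].
  by case: (eqVneq j o) => [_ | jo]; simp_scalars; rewrite ?mulr1n.
case: (eqVneq j o) => [jo | jo]; last by simp_scalars.
by rewrite -jo; simp_scalars.
Qed.

Lemma gens_base_sq_row i j k :
  (e i o * e o j) * (x ^+ 2 * e o k) =
    d j o *:
      (d k o *: (d i o *: x + d' i o *: (x ^+ 2 * e i o + e i o))
       + d' k o *:
         (d i o *: (x ^+ 2 * e o k)
          + d' i o *: (e o k * x * e i o + e i k)))
    - (d' j o * d k o * d i j * half) *: (x ^+ 3 - x).
Proof.
have [p po] := two_indices o n_ge2.
have x5 := base_expr5 two_reg n_ge2 eP po.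
rewrite /codelta /delta; case: (eqVneq k o) => [-> | ko].
  rewrite -exprSr; case: (eqVneq j o) => [-> | jo].
    case: (eqVneq i o) => [-> | io]; simp_scalars.
      by rewrite -[RHS]x5 -expr2 -exprD -exprSr.
    by rewrite -mulrA -exprS (gens_base4 two_reg n_ge2 eP po).
  rewrite (gens_cube two_reg n_ge2 eP po) //.
  case: (eqVneq i j) => [_ | ij]; simp_scalars => //.
  rewrite -(half_expr_sub po) -scalerAl mulrBl x5 -exprSr.
  by rewrite -scalerN opprB.
case: (eqVneq j o) => [-> | jo]; last first.
  by rewrite (gens_base_row_off two_reg n_ge2 eP) //; simp_scalars.
case: (eqVneq i o) => [-> | io]; simp_scalars; last first.
  by rewrite (gens_base_row_on two_reg n_ge2 eP po).
rewrite -mulrA [X in _ * X]mulrA -exprS (base_expr3_row two_reg n_ge2 eP) //.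
by rewrite mulrA expr2.
Qed.

Lemma gens_base_expr4 i j :
  (e i o * e o j) * x ^+ 4 =
    d j o *: (e i o * x)
    + (d' j o * d j i * half) *: (x ^+ 2 - x ^+ 4).
Proof.
have [p po] := two_indices o n_ge2.
rewrite /codelta /delta [j == i]eq_sym; case: (eqVneq j o) => [-> | jo].
  simp_scalars; rewrite -mulrA -exprS exprSr.
  by rewrite (base_expr5 two_reg n_ge2 eP po).
rewrite (gens_expr4 two_reg n_ge2 eP po) //.
case: (i == j); simp_scalars => //.
by rewrite -(half_expr_sub po) -scalerN opprB.
Qed.

End Scalars.

Theorem proposition4p4 (F : closedFieldType) (charF0 : [pchar F] =i pred0)
    (n : nat) (n_ge2 : (2 <= n)%N) (i j k l : 'I_n) :
  let o : 'I_n := Ordinal (ltnW n_ge2) in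
  let e : 'I_n -> 'I_n -> envelope F n := @envelope_gen F n in
  let d : 'I_n -> 'I_n -> F := @delta F n in
  let d' : 'I_n -> 'I_n -> F := @codelta F n in
  let half : F := 2^-1 in
  [/\ (e i o * e o j) * (e k o * e o l) =
        (d j k * d l o) *:
          ((d l j * d i o) *: e o o ^+ 4
           + (half * d' l j * d i o) *: (e o o ^+ 4 + e o o ^+ 2))
        + (half *
             (d j k * d' i o * d i l *
                (2 * d l j * d' l o + d' l j * (d j o + d' j o * d' l o))
              + d' j k * d k l * (d' j o * d' i o * d i j + d j o * d i o))) *:
            (e o o ^+ 4 - e o o ^+ 2)
        + (d j k *
             (d l o * d' i o + d l j * d' l o
              + d' l j * (d j o + d' j o * d' l o))) *:
            (e i o * e o l),
      (k, l) <> (o, o) ->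
      (e i o * e o j) * (e o k * e l o) =
        (d j o * d' k o * d k l * half) *:
          (d i o *: (e o o ^+ 4 + e o o ^+ 2)
           + (2 * d' i o) *: (e i o * e o o))
        - (d k o * (d j o * d i o + d' j o * d' l o * d i j)) *:
            (e o o * e l o),
      l <> o ->
      (e i o * e o j) * (e o k * e o o * e l o) =
        - ((d k o * (d i o * d j o + d' j o * d i j)) *: (e o o ^+ 2 * e l o)),
      (e i o * e o j) * (e o o ^+ 2 * e o k) =
        d j o *:
          (d k o *:
             (d i o *: e o o + d' i o *: (e o o ^+ 2 * e i o + e i o))
           + d' k o *:
             (d i o *: (e o o ^+ 2 * e o k)
              + d' i o *: (e o k * e o o * e i o + e i k)))
        - (d' j o * d k o * d i j * half) *: (e o o ^+ 3 - e o o)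
    & (e i o * e o j) * e o o ^+ 4 =
        d j o *: (e i o * e o o)
        + (d' j o * d j i * half) *: (e o o ^+ 2 - e o o ^+ 4)].
Proof.
have eP := @envelope_family F n.
have two0 := char0_two_neq0 charF0.
split.
- exact: four_gens.
- exact: mixed_gens.
- exact: mixed_gens_base.
- exact: gens_base_sq_row.
- exact: gens_base_expr4.
Qed.
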